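(* Let $Q$ be a quiver and $\mathbf d\in\mathbb Z_{\ge 0}^{Q_0}$ a dimension vector. The walls in $\mathrm{sst}(\mathbf d)$, namely the locus of $\theta\in\mathrm{sst}(\mathbf d)$ such that $\mathrm R_{\mathbf d}^{\theta\text{-st}}\subsetneq \mathrm R_{\mathbf d}^{\theta\text{-sst}}$, are a union of sets of the form $W_{\mathbf e}$, where $\mathbf e\in\mathbb Z_{\ge 0}^{Q_0}$ is a nonzero vector such that $\mathbf e\ne\mathbf d$ and $\mathbf e_i\le \mathbf d_i$ for each $i\in Q_0$, and $$W_{\mathbf e}=\mathrm{sst}(\mathbf e)\cap\mathrm{sst}(\mathbf d-\mathbf e).$$
   Context: Work over an algebraically closed field $k$ of characteristic zero. A quiver $Q$ is a finite directed graph (oriented cycles, loops and multiple arrows allowed) with vertex set $Q_0$, arrow set $Q_1$ and source and target maps $s,t:Q_1\to Q_0$. For a dimension vector $\mathbf d\in\mathbb Z_{\ge0}^{Q_0}$ let $\mathrm R_{\mathbf d}=\bigoplus_{a\in Q_1}\mathrm{Hom}(k^{\mathbf d_{s(a)}},k^{\mathbf d_{t(a)}})$; its elements are the representations of $Q$ of dimension vector $\mathbf d$. For $\theta\in\mathbb R^{Q_0}$ and a dimension vector $\mathbf e$ put $\theta(\mathbf e)=\sum_{i\in Q_0}\theta_i\mathbf e_i$, and for a representation $M$ of dimension vector $\mathbf e$ put $\theta(M)=\theta(\mathbf e)$. A representation $M$ is $\theta$-semistable (resp. $\theta$-stable) if $\theta(M)=0$ and $\theta(M')\le 0$ (resp.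 $\theta(M')<0$) for all proper nonzero subrepresentations $M'\subset M$. Let $\mathrm R_{\mathbf d}^{\theta\text{-st}}\subseteq\mathrm R_{\mathbf d}^{\theta\text{-sst}}\subseteq \mathrm R_{\mathbf d}$ be the sets of $\theta$-stable and $\theta$-semistable representations. Let ${}^\perp\mathbf d=\{\theta\in\mathbb R^{Q_0}\mid\theta(\mathbf d)=0\}$ and $\mathrm{sst}(\mathbf d)=\{\theta\in{}^\perp\mathbf d\mid \mathrm R_{\mathbf d}^{\theta\text{-sst}}\neq\emptyset\}$. *)

(* Defs.v *)
From HB Require Import structures.
From mathcomp Require Import all_boot all_order all_algebra.
From mathcomp Require Import boolp classical_sets reals.

Set Implicit Arguments.
Unset Strict Implicit.
Unset Printing Implicit Defensive.

Import GRing.Theory Num.Theory.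
Local Open Scope classical_set_scope.
Local Open Scope ring_scope.

Record quiver := Quiver {
  vertex : finType;
  arrow : finType;
  src : arrow -> vertex;
  tgt : arrow -> vertex
}.

Definition dimvec (Q : quiver) := {ffun vertex Q -> nat}.

Definition weight (R : realType) (Q : quiver) := {ffun vertex Q -> R}.

Definition rep (k : fieldType) (Q : quiver) (d : dimvec Q) :=
  forall a : arrow Q, 'Hom('rV[k]_(d (src a)), 'rV[k]_(d (tgt a))).

Definition pairing (R : realType) (Q : quiver) (theta : weight R Q)
    (e : dimvec Q) : R :=
  \sum_(i : vertex Q) theta i * (e i)%:R.

Section Subrepresentations.
Variables (k : fieldType) (Q : quiver) (d : dimvec Q).

Definition subfamily := forall i : vertex Q, {vspace 'rV[k]_(d i)}.

Definition is_subrep (M : rep k d) (U : subfamily) : Prop :=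
  forall a : arrow Q, (M a @: U (src a) <= U (tgt a))%VS.

Definition nonzero_family (U : subfamily) : Prop :=
  exists i, U i <> 0%VS.

Definition proper_family (U : subfamily) : Prop :=
  exists i, U i <> fullv.

Definition dim_family (U : subfamily) : dimvec Q := [ffun i => \dim (U i)].

End Subrepresentations.

Section Stability.
Unset Implicit Arguments.
Variables (k : fieldType) (R : realType) (Q : quiver).

Definition semistable (theta : weight R Q) (d : dimvec Q) (M : rep k d) : Prop :=
  pairing theta d = 0 /\
  forall U : subfamily k d, is_subrep M U ->
    nonzero_family U -> proper_family U ->
    pairing theta (dim_family U) <= 0.

Definition stable (theta : weight R Q) (d : dimvec Q) (M : rep k d) : Prop :=
  pairing theta d = 0 /\
  forall U : subfamily k d, is_subrep M U ->
    nonzero_family U -> proper_family U ->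
    pairing theta (dim_family U) < 0.

Definition Rsst (theta : weight R Q) (d : dimvec Q) : set (rep k d) :=
  [set M | semistable theta d M].

Definition Rst (theta : weight R Q) (d : dimvec Q) : set (rep k d) :=
  [set M | stable theta d M].

Definition perp (d : dimvec Q) : set (weight R Q) :=
  [set theta | pairing theta d = 0].

Definition sst (d : dimvec Q) : set (weight R Q) :=
  [set theta | perp d theta /\ Rsst theta d !=set0].

Definition walls (d : dimvec Q) : set (weight R Q) :=
  [set theta | sst d theta /\ Rst theta d `<` Rsst theta d].

(* The subtraction on nat is truncated; W is only used for e <= d. *)
Definition subdim (d e : dimvec Q) : dimvec Q := [ffun i => (d i - e i)%N].

Definition W (d e : dimvec Q) : set (weight R Q) :=
  sst e `&` sst (subdim d e).

End Stability.

Set Implicit Arguments.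

Arguments semistable {k R Q} theta d M.
Arguments stable {k R Q} theta d M.
Arguments Rsst k {R Q} theta d _.
Arguments Rst k {R Q} theta d _.
Arguments perp R {Q} d _.
Arguments sst k R {Q} d _.
Arguments walls k R {Q} d _.
Arguments subdim {Q} d e.
Arguments W k R {Q} d e _.

Definition wall_dimvec (Q : quiver) (d : dimvec Q) : set (dimvec Q) :=
  [set e : dimvec Q | [/\ e <> [ffun=> 0%N], e <> d & forall i, (e i <= d i)%N]].

(* Main.v *)
Require Import Defs.
From HB Require Import structures.
From mathcomp Require Import all_boot all_order all_algebra.
From mathcomp Require Import boolp classical_sets reals.

Set Implicit Arguments.
Unset Strict Implicit.
Unset Printing Implicit Defensive.

Import Order.POrderTheory GRing.Theory Num.Theory.
Local Open Scope classical_set_scope.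
Local Open Scope ring_scope.

(** The family of all wall vectors [e] works: a weight [theta] lies on a wall
    exactly when it lies in some [W e].

    If [M] is [theta]-semistable but not [theta]-stable, then some nonzero
    proper subrepresentation [U] satisfies [theta(U) = 0].  Subrepresentations
    of [U] are subrepresentations of [M], and subrepresentations of [M / U] are
    of the form [U' / U], of weight [theta(U')]; so [U] and [M / U] are both
    semistable, and [theta] is in [W (dim U)] (lemmas [semistable_sub],
    [semistable_quo] and [subrep_exact]).  Conversely, given semistable [N] and
    [P] of dimensions [e] and [d - e], the direct sum of [N] and [P] is
    semistable because each of its subrepresentations [U] is an extension of
    the image of [U] in [P] by the intersection of [U] with [N]; it is not
    stable because [N] has weight [0] (lemmas [semistable_ext] and
    [split_exact]).

    The spaces of a representation are coordinate spaces indexed by the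
    dimension vector, so [U] and [M / U] are not literally representations.
    Both directions are therefore phrased with short exact sequences
    [0 -> N -> M -> P -> 0], whose ends may have any dimension vectors that
    are propositionally the right ones. *)

(** * Short exact sequences of vector spaces *)

Lemma dim_rV (k : fieldType) (n : nat) : \dim {:'rV[k]_n} = n.
Proof. by rewrite dimvf dim_matrix; apply: mul1n. Qed.

(** [U] is an extension of its image under [g] by [U :&: lker g], and the latter
    is isomorphic to the preimage of [U] under the injection [f]. *)
Lemma dim_exact (k : fieldType) (aT vT cT : vectType k) (f : 'Hom(aT, vT))
    (g : 'Hom(vT, cT)) (U : {vspace vT}) :
  lker f == 0%VS -> limg f = lker g ->
  (\dim (f @^-1: U) + \dim (g @: U))%N = \dim U.
Proof.
move=> kf0 fg; rewrite -(limg_ker_dim g U) -fg -lpreim_cap_limg; congr addn.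
rewrite -[in RHS](lpreimK (capvSr U (limg f))) limg_dim_eq //.
by rewrite (eqP kf0) capv0.
Qed.

Lemma lpreimK_sur (k : fieldType) (vT cT : vectType k) (g : 'Hom(vT, cT))
    (V : {vspace cT}) : limg g = fullv -> (g @: (g @^-1: V))%VS = V.
Proof. by move=> gs; rewrite lpreimK // gs subvf. Qed.

(** Coordinates with respect to a basis of [U]. *)
Lemma vspace_param (k : fieldType) (vT : vectType k) (U : {vspace vT}) (m : nat) :
  \dim U = m ->
  exists2 f : 'Hom('rV[k]_m, vT), lker f == 0%VS & limg f = U.
Proof.
move=> <-; pose b := vbasis U.
pose h := fun c : 'rV[k]_(\dim U) => \sum_i c 0 i *: b`_i.
have hl : linear h.
  move=> a x y; rewrite /h scaler_sumr -big_split; apply: eq_bigr => i _ /=.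
  by rewrite !mxE scalerDl scalerA.
pose hL := GRing.isLinear.Build _ _ _ _ h hl.
pose hH : {linear 'rV[k]_(\dim U) -> vT} := HB.pack h hL.
have hE x : linfun hH x = h x by rewrite lfunE.
exists (linfun hH).
  apply/lker0P => x y; rewrite !hE => hxy; apply/rowP => i.
  have bf := basis_free (vbasisP U).
  by rewrite -(coord_sum_free (x 0) i bf) -(coord_sum_free (y 0) i bf) -/(h x) hxy.
apply/vspaceP => v; apply/memv_imgP/idP => [[c _ ->]|vU].
  by rewrite hE; apply: memv_suml => i _; rewrite memvZ // vbasis_mem // memt_nth.
exists (\row_i coord b i v); rewrite ?memvf // hE /h {1}(coord_vbasis vU).
by apply: eq_bigr => i _; rewrite mxE.
Qed.

(** The map onto the quotient by [U] is realized as the projection onto a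
    complement of [U], followed by coordinates on that complement. *)
Lemma vspace_exact (k : fieldType) (vT : vectType k) (U : {vspace vT}) (m p : nat) :
  \dim U = m -> (m + p)%N = \dim {:vT} ->
  exists f : 'Hom('rV[k]_m, vT), exists g : 'Hom(vT, 'rV[k]_p),
    [/\ lker f == 0%VS, limg f = U, lker g = U & limg g = fullv].
Proof.
move=> dU mp; have [f f0 fU] := vspace_param dU.
have dC : \dim U^C = p by rewrite dimv_compl -mp dU addKn.
have [h h0 hU] := vspace_param dC.
pose g := (h^-1 \o (\1 - projv U))%VF.
have gE x : g x = (h^-1)%VF (x - projv U x).
  by rewrite comp_lfunE add_lfunE opp_lfunE id_lfunE.
have gs : limg g = fullv.
  apply/vspaceP => y; rewrite memvf; apply/memv_imgP.
  exists (h y); rewrite ?memvf // gE.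
  have /eqP -> : projv U (h y) == 0.
    by rewrite -memv_ker lker_proj -hU memv_img ?memvf.
  by rewrite subr0 lker0_lfunK.
exists f, g; split=> //; apply/eqP; rewrite eq_sym eqEdim; apply/andP; split.
  by apply/subvP => x xU; rewrite memv_ker gE projv_id // subrr linear0.
have := limg_ker_dim g fullv; rewrite capfv gs dim_rV dU -mp.
by move/addIn=> ->.
Qed.

(** * Short exact sequences of representations *)

Section ExactSequences.
Variables (k : fieldType) (R : realType) (Q : quiver).
Implicit Types (d e c : dimvec Q) (theta : weight R Q).

Definition exact_rep e d c (N : rep k e) (M : rep k d) (P : rep k c)
    (f : forall i, 'Hom('rV[k]_(e i), 'rV[k]_(d i)))
    (g : forall i, 'Hom('rV[k]_(d i), 'rV[k]_(c i))) : Prop :=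
  [/\ forall i, [/\ lker (f i) == 0%VS, limg (f i) = lker (g i)
                  & limg (g i) = fullv],
      forall a x, f (tgt a) (N a x) = M a (f (src a) x)
    & forall a x, g (tgt a) (M a x) = P a (g (src a) x)].

Lemma is_subrepP d (M : rep k d) (U : subfamily k d) :
  is_subrep M U <-> forall a x, x \in U (src a) -> M a x \in U (tgt a).
Proof.
split=> [MU a x xU|MU a]; first by apply: (subvP (MU a)); apply: memv_img.
by apply/subvP => _ /memv_imgP[x xU ->]; apply: MU.
Qed.

Lemma pairingD theta d e c : (forall i, d i = (e i + c i)%N) ->
  pairing theta d = pairing theta e + pairing theta c.
Proof.
by move=> dE; rewrite -big_split; apply: eq_bigr => i _; rewrite dE natrD mulrDr.
Qed.

Lemma pairing0 theta : pairing theta [ffun=> 0%N] = 0.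
Proof. by rewrite /pairing big1 // => i _; rewrite ffunE mulr0. Qed.

Lemma dim_family_eq0 d (U : subfamily k d) :
  nonzero_family U <-> dim_family U <> [ffun=> 0%N].
Proof.
split=> [[i Ui] /ffunP/(_ i)|U0].
  by rewrite !ffunE => /eqP; rewrite dimv_eq0 => /eqP.
apply: contrapT => /forallNP Ui; apply: U0; apply/ffunP => i.
by have /contrapT Ui0 := Ui i; rewrite !ffunE Ui0 dimv0.
Qed.

Lemma dim_family_eqd d (U : subfamily k d) :
  proper_family U <-> dim_family U <> d.
Proof.
split=> [[i Ui] /ffunP/(_ i)|Ud].
  rewrite ffunE => Udi; apply: Ui; apply/eqP.
  by rewrite eqEdim subvf /= dim_rV Udi.
apply: contrapT => /forallNP Ui; apply: Ud; apply/ffunP => i.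
by have /contrapT Ui0 := Ui i; rewrite ffunE Ui0 dim_rV.
Qed.

(** The zero family and the full family have weight [0], so in semistability
    (unlike stability) they need not be excluded. *)
Lemma semistableE theta d (M : rep k d) : semistable theta d M <->
  pairing theta d = 0 /\
  forall U, is_subrep M U -> pairing theta (dim_family U) <= 0.
Proof.
split=> -[td MU]; split=> // U sU; last by move=> _ _; apply: MU.
have [U0|U0] := pselect (dim_family U = [ffun=> 0%N]).
  by rewrite U0 pairing0.
have [Ud|Ud] := pselect (dim_family U = d); first by rewrite Ud td.
by apply: MU => //; [apply/dim_family_eq0|apply/dim_family_eqd].
Qed.

Section Semistability.
Variables (e d c : dimvec Q) (N : rep k e) (M : rep k d) (P : rep k c).
Variable f : forall i, 'Hom('rV[k]_(e i), 'rV[k]_(d i)).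
Variable g : forall i, 'Hom('rV[k]_(d i), 'rV[k]_(c i)).
Hypothesis fgE : exact_rep N M P f g.
Variable theta : weight R Q.

Lemma dimvec_exact i : d i = (e i + c i)%N.
Proof.
case: fgE => /(_ i)[f0 fg gs] _ _; have := dim_exact fullv f0 fg.
have -> : (f i @^-1: fullv)%VS = fullv.
  by apply/vspaceP => x; rewrite -memv_preim !memvf.
by rewrite gs !dim_rV.
Qed.

Lemma subrep_img (V : subfamily k e) :
  is_subrep N V -> is_subrep M (fun i => f i @: V i)%VS.
Proof.
case: fgE => _ fM _ /is_subrepP NV; apply/is_subrepP => a _ /memv_imgP[x xV ->].
by rewrite -fM memv_img // NV.
Qed.

Lemma dim_family_img (V : subfamily k e) :
  dim_family (fun i => f i @: V i)%VS = dim_family V.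
Proof.
case: fgE => ex _ _; apply/ffunP => i; have [f0 _ _] := ex i.
by rewrite !ffunE limg_dim_eq // (eqP f0) capv0.
Qed.

(** The images under [f] are the subrepresentations of [M] inside [N]. *)
Lemma semistable_sub :
  pairing theta e = 0 -> semistable theta d M -> semistable theta e N.
Proof.
move=> te /semistableE[_ MU]; apply/semistableE; split=> // V sV.
by rewrite -dim_family_img MU //; apply: subrep_img.
Qed.

(** A subrepresentation of [P] and its preimage under [g] differ in dimension by
    [e], hence have the same weight. *)
Lemma semistable_quo :
  pairing theta e = 0 -> semistable theta d M -> semistable theta c P.
Proof.
move=> te /semistableE[td MU]; apply/semistableE; split.
  by rewrite -td (pairingD _ dimvec_exact) te add0r.
case: fgE => ex _ gM V /is_subrepP PV.
pose U : subfamily k d := fun i => (g i @^-1: V i)%VS.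
have sU : is_subrep M U.
  by apply/is_subrepP => a x; rewrite -!memv_preim gM => /PV.
have := MU U sU; rewrite (@pairingD _ _ e (dim_family V)) ?te ?add0r // => i.
have [f0 fg gs] := ex i; rewrite !ffunE -(dim_exact (U i) f0 fg).
rewrite /U lpreimK_sur //; congr addn.
have -> : (f i @^-1: (g i @^-1: V i) = fullv)%VS.
  apply/vspaceP => x; rewrite -!memv_preim memvf.
  have : f i x \in lker (g i) by rewrite -fg memv_img ?memvf.
  by rewrite memv_ker => /eqP ->; apply: mem0v.
exact: dim_rV.
Qed.

(** A subrepresentation of [M] has the weight of its preimage in [N] plus that of
    its image in [P], both nonpositive. *)
Lemma semistable_ext :
  semistable theta e N -> semistable theta c P -> semistable theta d M.
Proof.
move=> /semistableE[te NV] /semistableE[tc PV]; apply/semistableE; split.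
  by rewrite (pairingD _ dimvec_exact) te tc addr0.
case: fgE => ex fM gM U /is_subrepP MU.
pose V : subfamily k e := fun i => (f i @^-1: U i)%VS.
pose V' : subfamily k c := fun i => (g i @: U i)%VS.
have sV : is_subrep N V.
  by apply/is_subrepP => a x; rewrite -!memv_preim fM => /MU.
have sV' : is_subrep P V'.
  apply/is_subrepP => a _ /memv_imgP[x xU ->].
  by rewrite -gM memv_img // MU.
rewrite (@pairingD _ _ (dim_family V) (dim_family V')).
  by rewrite -[leRHS]addr0 lerD ?NV ?PV.
by move=> i; have [f0 fg _] := ex i; rewrite !ffunE dim_exact.
Qed.

(** The subobject [N] has weight [0], hence it destabilizes [M]. *)
Lemma exact_not_stable :
  e <> [ffun=> 0%N] -> e <> d -> pairing theta e = 0 -> ~ stable theta d M.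
Proof.
move=> e0 ed te [_ /(_ (fun i => f i @: fullv)%VS)].
have dE : dim_family (fun i => f i @: fullv)%VS = e.
  rewrite (dim_family_img (fun=> fullv)).
  by apply/ffunP => i; rewrite ffunE dim_rV.
rewrite dE te ltxx => st; suff : false by [].
apply: st; first by apply: subrep_img => a; apply: subvf.
  by apply/dim_family_eq0; rewrite dE.
by apply/dim_family_eqd; rewrite dE.
Qed.

End Semistability.

Lemma family_exact d e c (U : subfamily k d) :
  (forall i, \dim (U i) = e i) -> (forall i, (e i + c i)%N = d i) ->
  exists f : forall i, 'Hom('rV[k]_(e i), 'rV[k]_(d i)),
  exists g : forall i, 'Hom('rV[k]_(d i), 'rV[k]_(c i)),
  forall i, [/\ lker (f i) == 0%VS, limg (f i) = U i, lker (g i) = U i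
              & limg (g i) = fullv].
Proof.
move=> dU dE; have /(_ _)/cid fP i : exists f : 'Hom('rV[k]_(e i), 'rV[k]_(d i)),
    exists g : 'Hom('rV[k]_(d i), 'rV[k]_(c i)),
    [/\ lker f == 0%VS, limg f = U i, lker g = U i & limg g = fullv].
  by apply: vspace_exact; [exact: dU|rewrite dim_rV].
have /(_ _)/cid gP i := svalP (fP i).
by exists (fun i => sval (fP i)), (fun i => sval (gP i)) => i; apply: svalP (gP i).
Qed.

(** The arrows of [N] and [P] are transported from those of [M] through
    one-sided inverses of [f] and [g]; invariance of [U] makes the result
    compatible with [f] and [g]. *)
Lemma subrep_exact d (M : rep k d) (U : subfamily k d) : is_subrep M U ->
  exists N : rep k (dim_family U),
  exists P : rep k (subdim d (dim_family U)),
  exists f, exists g, exact_rep N M P f g.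
Proof.
move/is_subrepP=> MU.
have [||f [g fg]] := @family_exact d (dim_family U) (subdim d (dim_family U)) U.
- by move=> i; rewrite ffunE.
- by move=> i; rewrite !ffunE subnKC // -[leqRHS](dim_rV k) dimvS ?subvf.
exists (fun a => (f (tgt a))^-1 \o M a \o f (src a))%VF.
exists (fun a => g (tgt a) \o M a \o (g (src a))^-1)%VF.
exists f, g; split=> [i|a x|a x].
- by have [? -> -> ?] := fg i.
- have [_ fs _ _] := fg (src a); have [_ ft _ _] := fg (tgt a).
  by rewrite !comp_lfunE /= limg_lfunVK // ft MU // -fs memv_img ?memvf.
- have [_ _ ks gs] := fg (src a); have [_ _ kt _] := fg (tgt a).
  rewrite !comp_lfunE; apply/eqP; rewrite -subr_eq0 -!linearB -memv_ker kt.
  apply: MU; rewrite -ks memv_ker linearB /= limg_lfunVK ?subrr //.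
  by rewrite gs memvf.
Qed.

(** The middle term is the direct sum of [N] and [P], written in coordinates
    adapted to an arbitrary subspace of the right dimension at each vertex. *)
Lemma split_exact d e (N : rep k e) (P : rep k (subdim d e)) :
  (forall i, (e i <= d i)%N) ->
  exists M : rep k d, exists f, exists g, exact_rep N M P f g.
Proof.
move=> ed; have /(_ _)/cid UP i : exists U : {vspace 'rV[k]_(d i)}, \dim U = e i.
  pose X := take (e i) (vbasis {:'rV[k]_(d i)}).
  have fX : free X.
    have := basis_free (vbasisP {:'rV[k]_(d i)}).
    by rewrite -{1}(cat_take_drop (e i) (vbasis _)) => /catl_free.
  by exists <<X>>%VS; rewrite (eqP fX) size_takel // size_tuple dim_rV.
have [||f [g fg]] := @family_exact d e (subdim d e) (fun i => sval (UP i)).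
- by move=> i; apply: svalP (UP i).
- by move=> i; rewrite ffunE subnKC.
have {}fg i : [/\ lker (f i) == 0%VS, limg (f i) = lker (g i)
    & limg (g i) = fullv].
  by have [f0 -> -> gs] := fg i.
have gf i x : g i (f i x) = 0.
  have [_ fgi _] := fg i.
  by apply/eqP; rewrite -memv_ker -fgi memv_img ?memvf.
exists (fun a => (f (tgt a) \o N a \o (f (src a))^-1)
  + ((g (tgt a))^-1 \o P a \o g (src a)))%VF.
exists f, g; split=> // a x.
- have [f0 _ _] := fg (src a).
  by rewrite add_lfunE !comp_lfunE lker0_lfunK // gf !linear0 addr0.
- have [_ _ gs] := fg (tgt a).
  by rewrite add_lfunE !comp_lfunE linearD /= gf add0r limg_lfunVK ?gs ?memvf.
Qed.

End ExactSequences.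

(** * Walls *)

Theorem theorem1p1 (k : closedFieldType) (k_char0 : [pchar k] =i pred0)
    (R : realType) (Q : quiver) (d : dimvec Q) :
  exists2 E : set (dimvec Q), E `<=` wall_dimvec d &
    walls k R d = \bigcup_(e in E) W k R d e.
Proof.
exists (wall_dimvec d) => //; apply/seteqP; split=> theta.
- move=> [[td _] [_ /nonsubset[M [Mss Mst]]]].
  have [U [sU U0 Ud tU]] : exists U : subfamily k d,
      [/\ is_subrep M U, nonzero_family U, proper_family U
        & pairing theta (dim_family U) = 0].
    apply: contrapT => noU; apply: Mst; split=> // U sU U0 Ud.
    rewrite lt_neqAle (proj2 Mss) // andbT; apply/eqP => tU.
    by apply: noU; exists U.
  have [N [P [f [g fgE]]]] := subrep_exact sU.
  have Nss := semistable_sub fgE tU Mss; have Pss := semistable_quo fgE tU Mss.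
  exists (dim_family U).
    split; [exact/dim_family_eq0|exact/dim_family_eqd|move=> i].
    by rewrite (dimvec_exact fgE) leq_addr.
  by split; (split; first by case: Nss Pss => ? _ [? _]); [exists N|exists P].
- move=> [e [e0 ed le_ed] [[te [N Nss]] [_ [P Pss]]]].
  have [M [f [g fgE]]] := split_exact N P le_ed.
  have Mss := semistable_ext fgE Nss Pss.
  split; first by split; [exact: (proj1 Mss)|exists M].
  split=> [L [tL Lst]|/(_ M Mss)]; last exact: (exact_not_stable fgE e0 ed te).
  by split=> // U sU U0 Ud; apply/ltW/Lst.
Qed.
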